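(* Let $X$ be a unital merge-bicategory, and $p: (\Gamma) \to (\Delta)$ a 2-cell of $X$ with $n$ inputs and $m$ outputs. The following are equivalent: 1. $p$ is universal at $\partial^+$; 2. $p$ is universal at $\partial^-$; 3. $p$ is an isomorphism, that is, it has a unique inverse $p^{-1}: (\Delta) \to (\Gamma)$ such that $\mathrm{mrg}_{[1,m]}^{[1,m]}(p,p^{-1})= \mathrm{id}_{\Gamma}$, and $\mathrm{mrg}_{[1,n]}^{[1,n]}(p^{-1},p) = \mathrm{id}_{\Delta}$.
   Context: A regular 2-polygraph $X$ consists of a set of 0-cells, a set of 1-cells $a: x \to y$ (each with a source and a target 0-cell), and, for all $n,m\ge 1$, a set of 2-cells $p:(a_1,\ldots,a_n)\to(b_1,\ldots,b_m)$, whose input $(a_i)$ and output $(b_j)$ are non-empty composable sequences of 1-cells (the target of each is the source of the next) with the same initial source and the same final target. Greek capitals denote possibly empty composable sequences of 1-cells (the input and output of a 2-cell being non-empty), and commas denote concatenation. A merge-bicategory is a regular 2-polygraph with operations: given $t:(\Gamma)\to(\Delta_1,\Lambda,\Delta_2)$ and $s:(\Gamma_1,\Lambda,\Gamma_2)\to(\Delta)$ with $\Lambda$ non-empty, occupying outputs $j_1,\ldots,j_2$ of $t$ and inputs $i_1,\ldots,i_2$ of $s$, such that ($\Gamma_1$ or $\Delta_1$ is empty) and ($\Gamma_2$ or $\Delta_2$ is empty), a 2-cell $\mathrm{mrg}_{[j_1,j_2]}^{[i_1,i_2]}(t,s):(\Gamma_1,\Gamma,\Gamma_2)\to(\Delta_1,\Delta,\Delta_2)$.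 These satisfy associativity and interchange equations: whenever the same pasting diagram of three 2-cells (with the same identifications of output 1-cells with input 1-cells) can be evaluated by two successive merges in two different orders, the two results are equal. No units are part of the structure. A 2-cell $t:(\Gamma)\to(\Delta)$ is universal at $\partial^+$ (i.e. at its whole output) if for all $\Gamma_1,\Gamma_2$ and non-empty $\Delta'$, every 2-cell $s:(\Gamma_1,\Gamma,\Gamma_2)\to(\Delta')$ equals the merge of $t$ and $r$ along $\Delta$ for a unique $r:(\Gamma_1,\Delta,\Gamma_2)\to(\Delta')$. Dually, $t$ is universal at $\partial^-$ (its whole input) if for all $\Delta_1,\Delta_2$ and non-empty $\Gamma'$, every $s:(\Gamma')\to(\Delta_1,\Delta,\Delta_2)$ equals the merge of $r$ and $t$ along $\Gamma$ for a unique $r:(\Gamma')\to(\Delta_1,\Gamma,\Delta_2)$. For a non-empty composable sequence $\Gamma$, a unit on $\Gamma$ is a 2-cell $\mathrm{id}_\Gamma:(\Gamma)\to(\Gamma)$ such that merging any 2-cell $t$ with $\mathrm{id}_\Gamma$ along the whole of $\Gamma$, whenever $\Gamma$ occurs as a segment of the outputs or of the inputs of $t$, gives $t$. $X$ is unital if every non-empty composable sequence of 1-cells has a (necessarily unique) unit. *)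

(* Defs.v *)
From mathcomp Require Import all_boot.

Set Implicit Arguments.
Unset Strict Implicit.
Unset Printing Implicit Defensive.

(* An interval [i1,i2] of positions in a sequence is the pair (i1, i2): positions
   are counted from 1 and both ends are included. *)
Definition interval := (nat * nat)%type.

Definition is_interval {T : Type} (K : interval) (l : seq T) : bool :=
  [&& 0 < K.1, K.1 <= K.2 & K.2 <= size l].

Definition before {T : Type} (K : interval) (l : seq T) : seq T :=
  take K.1.-1 l.
Definition segment {T : Type} (K : interval) (l : seq T) : seq T :=
  drop K.1.-1 (take K.2 l).
Definition after {T : Type} (K : interval) (l : seq T) : seq T :=
  drop K.2 l.

Definition splice {T : Type} (K : interval) (l u : seq T) : seq T :=
  before K l ++ u ++ after K l.

(* The interval occupied by u in l ++ u ++ r. *)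
Definition interval_of {T : Type} (l u : seq T) : interval :=
  ((size l).+1, size l + size u).

Fixpoint joins {C0 C1 : Type} (src tgt : C1 -> C0)
    (x : C0) (l : seq C1) (y : C0) : Prop :=
  if l is a :: l' then src a = x /\ joins src tgt (tgt a) l' y else x = y.

(* The sets of 2-cells (a_1,..,a_n) -> (b_1,..,b_m), for all n, m >= 1, are
   gathered in one type with input and output maps. *)
Record regular2Polygraph : Type := Regular2Polygraph {
  cell0 : Type;
  cell1 : Type;
  src : cell1 -> cell0;
  tgt : cell1 -> cell0;
  cell2 : Type;
  input : cell2 -> seq cell1;
  output : cell2 -> seq cell1;
  input_neq0 : forall p, input p <> [::];
  output_neq0 : forall p, output p <> [::];
  parallel : forall p, exists x y,
    joins src tgt x (input p) y /\ joins src tgt x (output p) y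
}.

Definition composable {X : regular2Polygraph} (G : seq (cell1 X)) : Prop :=
  exists x y, joins (@src X) (@tgt X) x G y.

Definition has_type {X : regular2Polygraph} (p : cell2 X)
    (G D : seq (cell1 X)) : Prop :=
  input p = G /\ output p = D.

Definition mergeable {X : regular2Polygraph} (J K : interval)
    (t s : cell2 X) : Prop :=
  [/\ is_interval J (output t), is_interval K (input s),
      segment J (output t) = segment K (input s),
      before K (input s) = [::] \/ before J (output t) = [::]
    & after K (input s) = [::] \/ after J (output t) = [::]].

(* A bracketed pasting of cells labelled by 'I_3; [Merge J K T U] glues the
   outputs J of T to the inputs K of U. Labels let one 2-cell be used twice. *)
Inductive pasting : Type :=
  | Cell of 'I_3
  | Merge of interval & interval & pasting & pasting.

Fixpoint labels (T : pasting) : seq 'I_3 :=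
  match T with
  | Cell x => [:: x]
  | Merge _ _ T U => labels T ++ labels U
  end.

Fixpoint evaluate {C : Type} (mrg : interval -> interval -> C -> C -> option C)
    (c : 'I_3 -> C) (T : pasting) : option C :=
  match T with
  | Cell x => Some (c x)
  | Merge J K T U =>
      if evaluate mrg c T is Some t then
        if evaluate mrg c U is Some u then mrg J K t u else None
      else None
  end.

(* The port (x, k) is the k-th (from 0) input or output 1-cell of the cell
   labelled x; [in_ports] and [out_ports] list the ports left on the boundary,
   and [gluing] the pairs (output port, input port) that are identified. *)
Definition port := ('I_3 * nat)%type.

Definition ports (x : 'I_3) (n : nat) : seq port := [seq (x, k) | k <- iota 0 n].

Fixpoint in_ports {X : regular2Polygraph} (c : 'I_3 -> cell2 X)
    (T : pasting) : seq port :=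
  match T with
  | Cell x => ports x (size (input (c x)))
  | Merge _ K T U => splice K (in_ports c U) (in_ports c T)
  end.

Fixpoint out_ports {X : regular2Polygraph} (c : 'I_3 -> cell2 X)
    (T : pasting) : seq port :=
  match T with
  | Cell x => ports x (size (output (c x)))
  | Merge J _ T U => splice J (out_ports c T) (out_ports c U)
  end.

Fixpoint gluing {X : regular2Polygraph} (c : 'I_3 -> cell2 X)
    (T : pasting) : seq (port * port) :=
  match T with
  | Cell _ => [::]
  | Merge J K T U =>
      gluing c T ++ gluing c U
      ++ zip (segment J (out_ports c T)) (segment K (in_ports c U))
  end.

(* [mrg J K t s = None] means that the merge is not defined. Since every label
   is used exactly once in [mrgA], the pastings T and U there consist of two
   merges; both the associativity and the interchange equations are instances. *)
Record mergeBicategory : Type := MergeBicategory {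
  polygraph :> regular2Polygraph;
  mrg : interval -> interval -> cell2 polygraph -> cell2 polygraph ->
    option (cell2 polygraph);
  mrg_defined : forall J K t s,
    (exists u, mrg J K t s = Some u) <-> mergeable J K t s;
  mrg_type : forall J K t s u, mrg J K t s = Some u ->
    has_type u (splice K (input s) (input t)) (splice J (output t) (output s));
  mrgA : forall (c : 'I_3 -> cell2 polygraph) (T U : pasting) t u,
    perm_eq (labels T) (enum 'I_3) -> perm_eq (labels U) (enum 'I_3) ->
    gluing c T =i gluing c U ->
    evaluate mrg c T = Some t -> evaluate mrg c U = Some u -> t = u
}.

Arguments mrg {m} J K t s.

Definition whole {T : Type} (l : seq T) : interval := (1, size l).

Definition universal_output {X : mergeBicategory} (t : cell2 X) : Prop :=
  forall (G1 G2 D' : seq (cell1 X)) (s : cell2 X), D' <> [::] ->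
    has_type s (G1 ++ input t ++ G2) D' ->
    exists! r : cell2 X, has_type r (G1 ++ output t ++ G2) D' /\
      mrg (whole (output t)) (interval_of G1 (output t)) t r = Some s.

Definition universal_input {X : mergeBicategory} (t : cell2 X) : Prop :=
  forall (D1 D2 G' : seq (cell1 X)) (s : cell2 X), G' <> [::] ->
    has_type s G' (D1 ++ output t ++ D2) ->
    exists! r : cell2 X, has_type r G' (D1 ++ input t ++ D2) /\
      mrg (interval_of D1 (input t)) (whole (input t)) r t = Some s.

Definition is_unit {X : mergeBicategory} (G : seq (cell1 X)) (e : cell2 X) :
    Prop :=
  [/\ has_type e G G,
      forall (D1 D2 : seq (cell1 X)) (t : cell2 X),
        output t = D1 ++ G ++ D2 ->
        mrg (interval_of D1 G) (whole G) t e = Some t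
    & forall (G1 G2 : seq (cell1 X)) (t : cell2 X),
        input t = G1 ++ G ++ G2 ->
        mrg (whole G) (interval_of G1 G) e t = Some t].

Definition unital (X : mergeBicategory) : Prop :=
  forall G : seq (cell1 X), G <> [::] -> composable G ->
    exists e, is_unit G e.

Definition is_inverse {X : mergeBicategory} (p q : cell2 X) : Prop :=
  [/\ has_type q (output p) (input p),
      exists2 e, is_unit (input p) e &
        mrg (1, size (output p)) (1, size (output p)) p q = Some e
    & exists2 e, is_unit (output p) e &
        mrg (1, size (input p)) (1, size (input p)) q p = Some e].

Definition isomorphism {X : mergeBicategory} (p : cell2 X) : Prop :=
  exists! q : cell2 X, is_inverse p q.

(* Main.v *)
Require Import Defs.
From mathcomp Require Import all_boot.

(** Write [a . b] for a merge gluing outputs of [a] to inputs of [b]. Universality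
    of [p] at the output says that [s |-> p . s], gluing all of [output p], is a
    bijection from the 2-cells with input [G1, output p, G2] to those with input
    [G1, input p, G2], with the same output; universality at the input is the
    mirror statement.

    An inverse [q] of [p] makes both bijections explicit: associativity turns
    [p . (q . s)] into [(p . q) . s], which is a unit merged with [s], hence [s]
    ([mrg_inverse_before]); likewise on the other side ([mrg_inverse_after]).
    As [p] is in turn an inverse of [q], the two maps undo each other.

    Conversely, universality at the output factors the unit on [input p] as
    [p . q], which gives a one-sided inverse [q]; then [q . p] and the unit on
    [output p] both solve [p . r = p], whose solution is unique, so they agree
    ([universal_output_inverse]). The argument at the input is the mirror image
    ([universal_input_inverse]).

    All these steps rest on one instance of coherence ([mrg_assoc]): a cell [b]
    merged along its whole input with [a] and along its whole output with [c].
    The outputs of [a] and the inputs of [c] may extend beyond [b], so that the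
    same lemma serves both sides.

    Throughout, [interval_of [::] l] and [whole l] are convertible, so a merge
    along the whole of [l] is a special case of a merge along a segment. *)

(** * Segments of sequences *)

Lemma segment_whole {T : Type} (l : seq T) : segment (whole l) l = l.
Proof. by rewrite /segment /whole /= take_size drop0. Qed.

Lemma segment_interval_of {T : Type} (l u r : seq T) :
  segment (interval_of l u) (l ++ u ++ r) = u.
Proof.
by rewrite /segment /interval_of /= catA -size_cat take_size_cat ?drop_size_cat.
Qed.

Lemma before_interval_of {T : Type} (l u r : seq T) :
  before (interval_of l u) (l ++ u ++ r) = l.
Proof. by rewrite /before /interval_of /= take_size_cat. Qed.

Lemma after_interval_of {T : Type} (l u r : seq T) :
  after (interval_of l u) (l ++ u ++ r) = r.
Proof. by rewrite /after /interval_of /= catA -size_cat drop_size_cat. Qed.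

Lemma splice_interval_of {T : Type} (l u r v : seq T) :
  splice (interval_of l u) (l ++ u ++ r) v = l ++ v ++ r.
Proof. by rewrite /splice before_interval_of after_interval_of. Qed.

(** The intervals come from sequences of 1-cells but act on sequences of ports,
    hence the two types. *)
Lemma segment_splice {S T : Type} (l u v : seq S) (w x : seq T) :
  size l <= size w -> size x = size u ->
  segment (interval_of l u) (splice (interval_of l v) w x) = x.
Proof.
move=> le_lw eq_xu; rewrite /segment /splice /before /interval_of /= catA.
have sz_l : size (take (size l) w) = size l by rewrite size_takel.
by rewrite take_size_cat ?drop_size_cat // size_cat sz_l eq_xu.
Qed.

Lemma size_ports x n : size (ports x n) = n.
Proof. by rewrite size_map size_iota. Qed.

Lemma segment_ports {T : Type} (l : seq T) x :
  segment (whole l) (ports x (size l)) = ports x (size l).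
Proof. by have := segment_whole (ports x (size l)); rewrite /whole size_ports. Qed.

Lemma composable_input {X : regular2Polygraph} (p : cell2 X) :
  composable (input p).
Proof. by have [x [y [? _]]] := parallel p; exists x, y. Qed.

Lemma composable_output {X : regular2Polygraph} (p : cell2 X) :
  composable (output p).
Proof. by have [x [y [_ ?]]] := parallel p; exists x, y. Qed.

Lemma is_interval_of {T : Type} (l u r : seq T) :
  u <> [::] -> is_interval (interval_of l u) (l ++ u ++ r).
Proof.
move=> u0; rewrite /is_interval /interval_of catA 2!size_cat /= leq_addr andbT.
by case: u u0 => //= a u _; rewrite addnS ltnS leq_addr.
Qed.

(** * Merging along a common segment *)

Section Merge.
Context {X : mergeBicategory}.
Implicit Types (a b c p q r s : cell2 X) (D G : seq (cell1 X)).

Lemma mrg_interval_of_type {D1 D2 G1 G2 L : seq (cell1 X)} {t s u : cell2 X} :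
  output t = D1 ++ L ++ D2 -> input s = G1 ++ L ++ G2 ->
  mrg (interval_of D1 L) (interval_of G1 L) t s = Some u ->
  has_type u (G1 ++ input t ++ G2) (D1 ++ output s ++ D2).
Proof. by move=> ot is_ /mrg_type; rewrite ot is_ !splice_interval_of. Qed.

Lemma mrg_interval_of {D1 D2 G1 G2 L : seq (cell1 X)} {t s : cell2 X} :
  L <> [::] -> output t = D1 ++ L ++ D2 -> input s = G1 ++ L ++ G2 ->
  G1 = [::] \/ D1 = [::] -> G2 = [::] \/ D2 = [::] ->
  exists u, mrg (interval_of D1 L) (interval_of G1 L) t s = Some u.
Proof.
move=> L0 ot is_ h1 h2; apply/mrg_defined; split; rewrite ?ot ?is_.
- exact: is_interval_of.
- exact: is_interval_of.
- by rewrite !segment_interval_of.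
- by rewrite !before_interval_of.
- by rewrite !after_interval_of.
Qed.

(** The order of evaluation is immaterial because both bracketings identify the
    outputs of [a] with the inputs of [b] and the outputs of [b] with the inputs
    of [c]: their gluings differ only by the order in which the two lists of
    pairs are concatenated. *)
Lemma mrg_assoc {D1 D2 G1 G2 a b c} {ab bc u v : cell2 X} :
  output a = D1 ++ input b ++ D2 -> input c = G1 ++ output b ++ G2 ->
  mrg (interval_of D1 (input b)) (whole (input b)) a b = Some ab ->
  mrg (interval_of D1 (output b)) (interval_of G1 (output b)) ab c = Some u ->
  mrg (whole (output b)) (interval_of G1 (output b)) b c = Some bc ->
  mrg (interval_of D1 (input b)) (interval_of G1 (input b)) a bc = Some v ->
  u = v.
Proof.
move=> oa ic eab eu ebc ev.
pose cells (i : 'I_3) := nth c [:: a; b; c] i.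
pose i0 : 'I_3 := @Ordinal 3 0 isT.
pose i1 : 'I_3 := @Ordinal 3 1 isT.
pose i2 : 'I_3 := @Ordinal 3 2 isT.
pose T := Merge (interval_of D1 (output b)) (interval_of G1 (output b))
  (Merge (interval_of D1 (input b)) (whole (input b)) (Cell i0) (Cell i1))
  (Cell i2).
pose U := Merge (interval_of D1 (input b)) (interval_of G1 (input b))
  (Cell i0)
  (Merge (whole (output b)) (interval_of G1 (output b)) (Cell i1) (Cell i2)).
have labelsP : perm_eq [:: i0; i1; i2] (enum 'I_3).
  apply: uniq_perm; rewrite ?enum_uniq // => -[[|[|[|//]]] lt_i3];
  by rewrite mem_enum !inE.
apply: (@mrgA X cells T U u v labelsP labelsP); last 2 first.
- by rewrite /= eab eu.
- by rewrite /= ebc ev.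
have size_a : size D1 <= size (output a).
  by rewrite oa size_cat leq_addr.
have size_c : size G1 <= size (input c).
  by rewrite ic size_cat leq_addr.
move=> x; rewrite /= !segment_ports !segment_splice ?size_ports //.
by rewrite !mem_cat orbC.
Qed.

(** * Cancelling a cell against its inverse *)

(** Exchanging the roles of [p] and [q] turns each cancellation lemma below into
    its converse, so that only one direction needs a proof. *)
Lemma is_inverse_sym {p q} : is_inverse p q -> is_inverse q p.
Proof.
move=> [[iq oq] [e ue pq] [f uf qp]]; split; first by split.
- by exists f; rewrite ?iq // oq.
- by exists e; rewrite ?oq // iq.
Qed.

Lemma mrg_inverse_before {p q s r G1 G2} :
  is_inverse p q -> input s = G1 ++ input p ++ G2 ->
  mrg (whole (input p)) (interval_of G1 (input p)) q s = Some r ->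
  mrg (whole (output p)) (interval_of G1 (output p)) p r = Some s.
Proof.
move=> [[iq oq] [e [_ _ unitl] pq] _] is_ qs.
have is' : input s = G1 ++ output q ++ G2 by rewrite oq.
have op : output p = [::] ++ input q ++ [::] by rewrite iq cats0.
have [ir _] : has_type r (G1 ++ input q ++ G2) (output s).
  have := @mrg_interval_of_type [::] [::] _ _ _ q s r _ is_ qs.
  by rewrite !cats0; apply.
have [s' ps'] : exists s',
    mrg (interval_of [::] (output p)) (interval_of G1 (output p)) p r = Some s'.
  apply: (mrg_interval_of (D2 := [::]) (G2 := G2)); rewrite ?cats0 -?iq //.
  - exact: input_neq0.
  - by right.
  - by right.
rewrite [LHS]ps'; congr Some; symmetry.
apply: (mrg_assoc op is'); rewrite ?iq ?oq; [exact: pq | | exact: qs | exact: ps'].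
exact: unitl is_.
Qed.

Lemma mrg_inverse_after {p q s r D1 D2} :
  is_inverse p q -> output s = D1 ++ output p ++ D2 ->
  mrg (interval_of D1 (output p)) (whole (output p)) s q = Some r ->
  mrg (interval_of D1 (input p)) (whole (input p)) r p = Some s.
Proof.
move=> [[iq oq] _ [e [_ unitr _] qp]] os sq.
have os' : output s = D1 ++ input q ++ D2 by rewrite iq.
have ip : input p = [::] ++ output q ++ [::] by rewrite oq cats0.
have [_ or] : has_type r (input s) (D1 ++ output q ++ D2).
  have := @mrg_interval_of_type _ _ [::] [::] _ s q r os _ sq.
  by rewrite !cats0; apply.
have [s' rs'] : exists s',
    mrg (interval_of D1 (input p)) (interval_of [::] (input p)) r p = Some s'.
  apply: (mrg_interval_of (D2 := D2) (G2 := [::])); rewrite ?cats0 -?oq //.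
  - exact: output_neq0.
  - by left.
  - by left.
rewrite [LHS]rs'; congr Some.
apply: (mrg_assoc os' ip); rewrite ?iq ?oq; [exact: sq | exact: rs' | exact: qp |].
exact: unitr os.
Qed.

(** * Invertibility and universality *)

Lemma inverse_universal_output {p q} : is_inverse p q -> universal_output p.
Proof.
move=> pq G1 G2 D' s _ [is_ os]; have [[iq oq] _ _] := pq.
have [r qs] : exists r,
    mrg (interval_of [::] (input p)) (interval_of G1 (input p)) q s = Some r.
  apply: (mrg_interval_of (D2 := [::]) (G2 := G2)); rewrite ?cats0 //.
  - exact: input_neq0.
  - by right.
  - by right.
exists r; split=> [|r' [[ir' _] pr']].
- split; last exact: mrg_inverse_before pq is_ qs.
  have := @mrg_interval_of_type [::] [::] _ _ _ q s r _ is_ qs.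
  by rewrite !cats0 iq os; apply.
- rewrite -iq in ir' pr'.
  have := mrg_inverse_before (is_inverse_sym pq) ir' pr'.
  by rewrite oq [LHS]qs => -[].
Qed.

Lemma inverse_universal_input {p q} : is_inverse p q -> universal_input p.
Proof.
move=> pq D1 D2 G' s _ [is_ os]; have [[iq oq] _ _] := pq.
have [r sq] : exists r,
    mrg (interval_of D1 (output p)) (interval_of [::] (output p)) s q = Some r.
  apply: (mrg_interval_of (D2 := D2) (G2 := [::])); rewrite ?cats0 //.
  - exact: output_neq0.
  - by left.
  - by left.
exists r; split=> [|r' [[_ or'] rp']].
- split; last exact: mrg_inverse_after pq os sq.
  have := @mrg_interval_of_type _ _ [::] [::] _ s q r os _ sq.
  by rewrite !cats0 oq is_; apply.
- rewrite -oq in or' rp'.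
  have := mrg_inverse_after (is_inverse_sym pq) or' rp'.
  by rewrite iq [LHS]sq => -[].
Qed.

(** Inverses are unique: if [q'] is another one, merging [q] with the unit
    [p . q'] gives [q] by the unit law and [q'] by cancellation. *)
Lemma inverse_isomorphism {p q} : is_inverse p q -> isomorphism p.
Proof.
move=> pq; exists q; split=> // q' [[iq' _] [e [_ unitr _] pq'] _].
have [[iq oq] _ _] := pq.
have iq'_q : input q' = [::] ++ input q ++ [::] by rewrite cats0 iq.
have oq_p : output q = [::] ++ input p ++ [::] by rewrite cats0.
have := mrg_inverse_before (r := e) (is_inverse_sym pq) iq'_q.
rewrite iq oq => /(_ pq').
by rewrite [LHS](unitr _ _ _ oq_p) => -[].
Qed.

(** The inverse is the factorization through [p] of the unit on [input p]. *)
Lemma universal_output_inverse {p} :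
  unital X -> universal_output p -> exists q, is_inverse p q.
Proof.
move=> units univ.
have [e ue] := units _ (@input_neq0 _ p) (composable_input p).
have [f uf] := units _ (@output_neq0 _ p) (composable_output p).
have [[ie oe] _ unit_e] := ue; have [[if_ of_] unit_f _] := uf.
have ip : input p = [::] ++ input p ++ [::] by rewrite cats0.
have op : output p = [::] ++ output p ++ [::] by rewrite cats0.
have [|q [[[]]]] := univ [::] [::] (input p) e (@input_neq0 _ p).
  by split; rewrite ?ie.
rewrite /= cats0 => iq oq pq _.
have op_q : output p = [::] ++ input q ++ [::] by rewrite cats0 iq.
have ip_q : input p = [::] ++ output q ++ [::] by rewrite cats0 oq.
have oq_p : output q = [::] ++ input p ++ [::] by rewrite cats0.
have [f' qp] : exists f',
    mrg (interval_of [::] (input p)) (interval_of [::] (input p)) q p = Some f'.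
  by apply: (mrg_interval_of _ oq_p ip); [exact: input_neq0 | left | left].
have type_f' : has_type f' (output p) (output p).
  by have := mrg_interval_of_type oq_p ip qp; rewrite !cats0 iq.
have pf' : mrg (whole (output p)) (interval_of [::] (output p)) p f' = Some p.
  have [p' pf'] : exists p',
      mrg (interval_of [::] (output p)) (interval_of [::] (output p)) p f'
      = Some p'.
    apply: (mrg_interval_of _ op); [exact: output_neq0 | | by left | by left].
    by rewrite cats0; case: type_f'.
  rewrite [LHS]pf'; congr Some; symmetry.
  apply: (mrg_assoc op_q ip_q); rewrite ?iq ?oq;
    [exact: pq | | exact: qp | exact: pf'].
  exact: unit_e ip.
(* Both are factorizations of [p] itself through [p]. *)
have f'f : f' = f.
  have [|r [_ uniq_r]] := univ [::] [::] (output p) p (@output_neq0 _ p).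
    by split; rewrite ?cats0.
  rewrite -(uniq_r f') -1?(uniq_r f) //; split=> //; rewrite ?cats0 //.
  exact: unit_f op.
by exists q; split; [split | exists e | exists f; rewrite // -f'f].
Qed.

(** The inverse is the factorization through [p] of the unit on [output p]. *)
Lemma universal_input_inverse {p} :
  unital X -> universal_input p -> exists q, is_inverse p q.
Proof.
move=> units univ.
have [e ue] := units _ (@input_neq0 _ p) (composable_input p).
have [f uf] := units _ (@output_neq0 _ p) (composable_output p).
have [[ie oe] _ unit_e] := ue; have [[if_ of_] unit_f _] := uf.
have ip : input p = [::] ++ input p ++ [::] by rewrite cats0.
have op : output p = [::] ++ output p ++ [::] by rewrite cats0.
have [|q [[[]]]] := univ [::] [::] (output p) f (@output_neq0 _ p).
  by split; rewrite ?of_.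
rewrite /= cats0 => iq oq qp _.
have op_q : output p = [::] ++ input q ++ [::] by rewrite cats0 iq.
have ip_q : input p = [::] ++ output q ++ [::] by rewrite cats0 oq.
have iq_p : input q = [::] ++ output p ++ [::] by rewrite cats0.
have [e' pq] : exists e',
    mrg (interval_of [::] (output p)) (interval_of [::] (output p)) p q
    = Some e'.
  by apply: (mrg_interval_of _ op iq_p); [exact: output_neq0 | left | left].
have type_e' : has_type e' (input p) (input p).
  by have := mrg_interval_of_type op iq_p pq; rewrite !cats0 oq.
have e'p : mrg (interval_of [::] (input p)) (whole (input p)) e' p = Some p.
  have [p' e'p] : exists p',
      mrg (interval_of [::] (input p)) (interval_of [::] (input p)) e' p
      = Some p'.
    apply: (mrg_interval_of (D2 := [::]) _ _ ip);
      [exact: input_neq0 | | by left | by left].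
    by rewrite cats0; case: type_e'.
  rewrite [LHS]e'p; congr Some.
  apply: (mrg_assoc op_q ip_q); rewrite ?iq ?oq;
    [exact: pq | exact: e'p | exact: qp |].
  exact: unit_f op.
(* Both are factorizations of [p] itself through [p]. *)
have e'e : e' = e.
  have [|r [_ uniq_r]] := univ [::] [::] (input p) p (@input_neq0 _ p).
    by split; rewrite ?cats0.
  rewrite -(uniq_r e') -1?(uniq_r e) //; split=> //; rewrite ?cats0 //.
  exact: unit_e ip.
by exists q; split; [split | exists e; rewrite // -e'e | exists f].
Qed.

End Merge.

Theorem proposition5p9 (X : mergeBicategory) (hX : unital X) (p : cell2 X) :
  [<-> universal_output p; universal_input p; isomorphism p].
Proof.
tfae.
- move=> /(universal_output_inverse hX)[q]; exact: inverse_universal_input.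
- move=> /(universal_input_inverse hX)[q]; exact: inverse_isomorphism.
- move=> [q [pq _]]; exact: inverse_universal_output pq.
Qed.
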